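(* Let $n\ge 1$, let $p_1,\dots,p_n\in(0,1]$, and let $\mathbf{s}$ be the optimal threshold of the game $\mathcal{G}(p_1,\dots,p_n)$. If $1\le R_{\mathbf{s}}\le\infty$, then $$\mathcal{V}(p_1,\dots,p_n)>\frac1e .$$
   Context: $\mathcal{G}(p_1,\dots,p_n)$ is the last-success game: independent Bernoulli variables $I_1,\dots,I_n$ with $P(I_i=1)=p_i>0$ are observed sequentially, and the player wins if he stops on the last variable equal to $1$. Put $q_i=1-p_i$, $r_i=p_i/q_i$ (with $r_i=\infty$ if $p_i=1$), $R_k=\sum_{i=k}^n r_i\in[0,\infty]$ (empty sum $=0$). The optimal threshold is $\mathbf{s}=\max\{1\le k\le n: R_k\ge 1\}$ if $R_1\ge 1$, and $\mathbf{s}=1$ otherwise; it is optimal to stop on the first $1$ among $I_{\mathbf{s}},\dots,I_n$. The optimal win probability is $$\mathcal{V}(p_1,\dots,p_n)=\Big(\prod_{j=\mathbf{s}}^n q_j\Big)\Big(\sum_{i=\mathbf{s}}^n r_i\Big)\ \text{ if } p_{\mathbf{s}}<1,\qquad \mathcal{V}(p_1,\dots,p_n)=\prod_{j=\mathbf{s}+1}^n q_j\ \text{ if } p_{\mathbf{s}}=1$$ (empty product $=1$). *)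

(* Defs.v *)
From HB Require Import structures.
From mathcomp Require Import all_boot all_order all_algebra.
From mathcomp Require Import all_classical all_reals all_analysis.
From mathcomp Require Import ring.

Set Implicit Arguments.
Unset Strict Implicit.
Unset Printing Implicit Defensive.

Import Order.TTheory GRing.Theory Num.Theory.

Local Open Scope ring_scope.

(* Indices are 0-based: p i is the success probability of the (i+1)-st
   variable. *)

(* x i = true encodes I_(i+1) = 1. *)
Definition outcome (n : nat) := {ffun 'I_n -> bool}.

(* Joint law of independent Bernoulli variables with parameters p i. *)
Definition prob (R : realType) (n : nat) (p : 'I_n -> R) (x : outcome n) : R :=
  \prod_(i < n) (if x i then p i else 1 - p i).

(* tau x is the index at which the player stops when x occurs; None means that
   he never stops. *)
Definition strategy (n : nat) := {ffun outcome n -> option 'I_n}.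

(* The decision to stop at k depends only on the variables observed up to k. *)
Definition nonanticipating (n : nat) (tau : strategy n) : bool :=
  [forall x : outcome n, forall y : outcome n, forall k : 'I_n,
     (tau x == Some k) && [forall j : 'I_n, (j <= k)%N ==> (x j == y j)]
       ==> (tau y == Some k)].

Definition wins (n : nat) (tau : strategy n) (x : outcome n) : bool :=
  if tau x is Some k then
    x k && [forall j : 'I_n, (k < j)%N ==> ~~ x j]
  else false.

Definition win_prob (R : realType) (n : nat) (p : 'I_n -> R)
    (tau : strategy n) : R :=
  \sum_(x : outcome n | wins tau x) prob p x.

(* There are finitely many strategies, and never stopping wins with probability
   0, so the default value 0 does not affect the maximum. *)
Definition game_value (R : realType) (n : nat) (p : 'I_n -> R) : R :=
  \big[Num.max/0]_(tau : strategy n | nonanticipating tau) win_prob p tau.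

Definition odds (R : realType) (n : nat) (p : 'I_n -> R) (i : 'I_n) : \bar R :=
  if p i == 1 then +oo%E else (p i / (1 - p i))%:E.

Definition tail_odds (R : realType) (n : nat) (p : 'I_n -> R) (k : nat) :
    \bar R :=
  (\sum_(i < n | (k <= i)%N) odds p i)%E.

(* Index 0 here is the value 1 of the 1-based convention. *)
Definition threshold (R : realType) (n : nat) (p : 'I_n.+1 -> R) : 'I_n.+1 :=
  if (1 <= tail_odds p 0)%E
  then [arg max_(k > ord0 | (1 <= tail_odds p k)%E) (k : nat)]
  else ord0.

(* In the first case p j < 1 for all j >= s, so no division is by 0: if p j = 1
   with s < j, then tail_odds p j = +oo, against the maximality of s. *)
Definition odds_formula (R : realType) (n : nat) (p : 'I_n.+1 -> R) : R :=
  let s := threshold p in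
  if p s < 1
  then (\prod_(j < n.+1 | (s <= j)%N) (1 - p j))
       * (\sum_(i < n.+1 | (s <= i)%N) p i / (1 - p i))
  else \prod_(j < n.+1 | (s < j)%N) (1 - p j).

Section OddsTheorem.
Variable R : realType.

Definition ptail n (p : 'I_n.+1 -> R) : 'I_n -> R := fun i => p (lift ord0 i).
Definition ocons n (b : bool) (x : outcome n) : outcome n.+1 :=
  [ffun i => if unlift ord0 i is Some j then x j else b].
Definition allq n (p : 'I_n -> R) : R := \prod_(j < n) (1 - p j).

Lemma ocons0 n b (x : outcome n) : ocons b x ord0 = b.
Proof. by rewrite ffunE unlift_none. Qed.

Lemma oconsS n b (x : outcome n) j : ocons b x (lift ord0 j) = x j.
Proof. by rewrite ffunE liftK. Qed.

Lemma sum_ocons n (F : outcome n.+1 -> R) :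
  \sum_x F x = \sum_x F (ocons true x) + \sum_x F (ocons false x).
Proof.
have -> : \sum_x F x = \sum_(bx : bool * outcome n) F (ocons bx.1 bx.2).
  rewrite (reindex (fun bx : bool * outcome n => ocons bx.1 bx.2)) //=.
  exists (fun x : outcome n.+1 => (x ord0, [ffun j => x (lift ord0 j)])).
    move=> [b x] _ /=; rewrite ocons0; congr pair.
    by apply/ffunP => j; rewrite ffunE oconsS.
  move=> x _; apply/ffunP => i; rewrite ffunE.
  by case: unliftP => [j ->|-> //=]; rewrite ffunE.
rewrite -(pair_bigA _ (fun b x => F (ocons b x))) /=.
by rewrite big_bool.
Qed.

Lemma prob_ocons n (p : 'I_n.+1 -> R) b x :
  prob p (ocons b x) = (if b then p ord0 else 1 - p ord0) * prob (ptail p) x.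
Proof.
rewrite /prob big_ord_recl ocons0; congr (_ * _).
by apply: eq_bigr => i _; rewrite oconsS.
Qed.

Lemma sum_none n (p : 'I_n -> R) (P : pred (outcome n)) :
  (forall x, P x = [forall j, ~~ x j]) -> \sum_(x | P x) prob p x = allq p.
Proof.
move=> PE; rewrite (big_pred1 [ffun => false]) => [|x].
  by apply: eq_bigr => i _; rewrite ffunE.
rewrite PE; apply/forallP/eqP => [h|-> j]; last by rewrite ffunE.
by apply/ffunP => j; rewrite ffunE; apply/negbTE.
Qed.

Lemma nonantP n (tau : strategy n) :
  reflect (forall (x y : outcome n) k, tau x = Some k ->
             (forall j : 'I_n, (j <= k)%N -> x j = y j) -> tau y = Some k)
          (nonanticipating tau).
Proof.
apply: (iffP forallP) => [h x y k tx xy|h x].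
  have /forallP/(_ y)/forallP/(_ k)/implyP := h x.
  move=> H; apply/eqP/H; rewrite tx eqxx /=.
  by apply/forallP => j; apply/implyP => /xy ->.
apply/forallP => y; apply/forallP => k; apply/implyP => /andP[/eqP tx /forallP xy].
by apply/eqP/(h x) => // j jk; apply/eqP/(implyP (xy j)).
Qed.

Definition Wb n (p : 'I_n.+1 -> R) (tau : strategy n.+1) b :=
  \sum_(x | wins tau (ocons b x)) prob (ptail p) x.

Lemma win_prob_rec n (p : 'I_n.+1 -> R) tau :
  win_prob p tau = p ord0 * Wb p tau true + (1 - p ord0) * Wb p tau false.
Proof.
rewrite /win_prob big_mkcond sum_ocons -!big_mkcond /= /Wb !mulr_sumr.
by congr (_ + _); apply: eq_bigr => x _; rewrite prob_ocons.
Qed.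

Lemma forall_ord0 n (P : pred 'I_n.+1) :
  P ord0 -> [forall j, P j] = [forall j : 'I_n, P (lift ord0 j)].
Proof.
move=> P0; apply/forallP/forallP => h j //.
by case: (unliftP ord0 j) => [i ->|->].
Qed.

Lemma Wb_stop n (p : 'I_n.+1 -> R) (tau : strategy n.+1) b :
  (forall x, tau (ocons b x) = Some ord0) -> Wb p tau b = if b then allq (ptail p) else 0.
Proof.
rewrite /Wb => h; case: b h => h.
  apply: sum_none => x; rewrite /wins h ocons0 /= forall_ord0 //=.
  by apply: eq_forallb => j; rewrite oconsS.
by rewrite big_pred0 // => x; rewrite /wins h ocons0.
Qed.

Lemma Wb_continue n (p : 'I_n.+1 -> R) (tau : strategy n.+1) (sub : strategy n) b :
  (forall x, tau (ocons b x) = omap (lift ord0) (sub x)) ->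
  Wb p tau b = win_prob (ptail p) sub.
Proof.
move=> h; apply: eq_bigl => x; rewrite /wins h; case: (sub x) => //= k.
rewrite oconsS; congr andb; rewrite forall_ord0 //.
by apply: eq_forallb => j; rewrite oconsS /= /bump /= !add1n ltnS.
Qed.

(* Value by backward induction; allq (ptail p) is the probability that no 1
   occurs after the first variable. *)
Fixpoint dp n : ('I_n -> R) -> R :=
  match n with
  | 0 => fun => 0
  | n'.+1 => fun p => p ord0 * Num.max (allq (ptail p)) (dp (ptail p))
                      + (1 - p ord0) * dp (ptail p)
  end.

Definition p01 n (p : 'I_n -> R) := forall i, 0 < p i <= 1.

Lemma allq_ge0 n (p : 'I_n -> R) : p01 p -> 0 <= allq p.
Proof.
by move=> h; apply: prodr_ge0 => i _; have /andP[_] := h i; rewrite subr_ge0.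
Qed.

Lemma dp_ge0 n (p : 'I_n -> R) : p01 p -> 0 <= dp p.
Proof.
elim: n p => //= n IH p h.
have h' : p01 (ptail p) by move=> i; apply: h.
have /andP[p0 p1] := h ord0.
rewrite addr_ge0 ?mulr_ge0 ?subr_ge0 ?IH ?(ltW p0) //.
by rewrite le_max IH // orbT.
Qed.

Lemma dp_ub n (p : 'I_n -> R) (tau : strategy n) : p01 p -> nonanticipating tau ->
  win_prob p tau <= dp p.
Proof.
elim: n p tau => [|n IH] p tau h /nonantP nt.
  by rewrite /win_prob big_pred0 // => x; rewrite /wins; case: (tau x) => // -[].
have h' : p01 (ptail p) by move=> i; apply: h.
have /andP[p0 p1] := h ord0.
have key b : Wb p tau b <= if b then Num.max (allq (ptail p)) (dp (ptail p)) else dp (ptail p).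
  have [/eqP t0|t0] := boolP (tau (ocons b [ffun => false]) == Some ord0).
    rewrite Wb_stop => [|x]; last first.
      apply: nt t0 _ => j; rewrite leqn0 => /eqP j0.
      by rewrite (_ : j = ord0) ?ocons0 //; apply: val_inj.
    by case: b {t0}; rewrite ?dp_ge0 // le_max lexx.
  pose sub : strategy n :=
    [ffun x => if tau (ocons b x) is Some k then unlift ord0 k else None].
  have tsub x : tau (ocons b x) = omap (lift ord0) (sub x).
    rewrite ffunE; case tx: (tau (ocons b x)) => [k|//].
    case: unliftP => [j -> //|k0].
    case/eqP: t0; rewrite k0 in tx; apply: nt tx _ => j; rewrite leqn0 => /eqP j0.
    by rewrite (_ : j = ord0) ?ocons0 //; apply: val_inj.
  rewrite (Wb_continue _ tsub).
  have le : win_prob (ptail p) sub <= dp (ptail p).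
    apply: IH => //; apply/nonantP => x y k sx xy.
    have : tau (ocons b y) = Some (lift ord0 k).
      apply: (nt (ocons b x)); first by rewrite tsub sx.
      move=> j; case: (unliftP ord0 j) => [i ->|-> _]; last by rewrite !ocons0.
      by rewrite !oconsS /= /bump /= !add1n ltnS => /xy.
    rewrite tsub; case: (sub y) => //= k' [kE]; congr Some.
      by apply: val_inj.
  by move: (win_prob _ sub) le => w le; case: (b) => //; rewrite le_max le orbT.
rewrite win_prob_rec /=; apply: lerD; apply: ler_wpM2l; rewrite ?subr_ge0 ?(ltW p0) //.
Qed.

Lemma dp_attained n (p : 'I_n -> R) : p01 p ->
  exists2 tau, nonanticipating tau & win_prob p tau = dp p.
Proof.
elim: n p => [|n IH] p h.
  exists [ffun => None]; first by apply/nonantP => x y [].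
  by rewrite /win_prob big_pred0 // => x; rewrite /wins ffunE.
have h' : p01 (ptail p) by move=> i; apply: h.
have [t /nonantP nt Wt] := IH _ h'.
pose c := dp (ptail p) <= allq (ptail p).
pose ot (x : outcome n.+1) : outcome n := [ffun j => x (lift ord0 j)].
have otK b x : ot (ocons b x) = x by apply/ffunP => j; rewrite ffunE oconsS.
pose tau : strategy n.+1 :=
  [ffun x : outcome n.+1 => if x ord0 && c then Some ord0 else omap (lift ord0) (t (ot x))].
exists tau.
  apply/nonantP => x y k; rewrite !ffunE => tx xy.
  rewrite -(xy ord0) //; case: ifP tx => // _.
  case tx: (t (ot x)) => [k'|//] /= [kE].
  rewrite (nt (ot x) (ot y) k') //= ?kE // => j jk; rewrite !ffunE xy // -kE.
  by rewrite /= /bump /= !add1n ltnS.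
rewrite win_prob_rec /=; congr (_ * _ + _ * _).
  have [hc|hc] := boolP c.
    rewrite Wb_stop => [|x]; last by rewrite ffunE ocons0 hc.
    by rewrite max_l.
  rewrite (@Wb_continue _ _ _ t) => [|x]; last by rewrite ffunE ocons0 (negbTE hc) otK.
  by rewrite Wt max_r // ltW // ltNge.
by rewrite (@Wb_continue _ _ _ t) // => x; rewrite ffunE ocons0 otK.
Qed.

Lemma game_value_dp n (p : 'I_n -> R) : p01 p -> game_value p = dp p.
Proof.
move=> h; apply/eqP; rewrite eq_le; apply/andP; split.
  by apply/bigmax_leP; split => [|tau nt]; [exact: dp_ge0|exact: dp_ub].
by have [tau nt <-] := dp_attained h; apply: le_bigmax_cond.
Qed.

Lemma odds_ge0 n (p : 'I_n -> R) i : p01 p -> (0 <= odds p i)%E.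
Proof.
move=> h; rewrite /odds; have /andP[p0 p1] := h i; case: ifP => // _.
by rewrite lee_fin divr_ge0 ?subr_ge0 // ltW.
Qed.

Lemma tail_odds_anti n (p : 'I_n -> R) k l : p01 p -> (k <= l)%N ->
  (tail_odds p l <= tail_odds p k)%E.
Proof.
move=> h kl; rewrite /tail_odds big_mkcond [leRHS]big_mkcond.
apply: lee_sum => i _; have [li|//] := leqP l i.
  by rewrite (leq_trans kl li).
by case: ifP => // _ _; apply: odds_ge0.
Qed.

Lemma tail_oddsS n (p : 'I_n.+1 -> R) k : tail_odds p k.+1 = tail_odds (ptail p) k.
Proof. by rewrite /tail_odds big_mkcond big_ord_recl /= add0e -big_mkcond. Qed.

Lemma tail_odds0 n (p : 'I_n.+1 -> R) :
  tail_odds p 0 = (odds p ord0 + tail_odds (ptail p) 0)%E.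
Proof. by rewrite /tail_odds big_ord_recl. Qed.

Lemma tail_odds_fin n (p : 'I_n -> R) : p01 p -> (tail_odds p 0 < 1)%E ->
  (forall i, p i < 1) /\ tail_odds p 0 = (\sum_i p i / (1 - p i))%:E.
Proof.
move=> h R1.
have p1 i : p i < 1.
  have /andP[_] := h i; rewrite le_eqVlt => /orP[/eqP pi|//].
  suff : (odds p i < 1)%E by rewrite /odds pi eqxx.
  apply: le_lt_trans R1; rewrite /tail_odds (bigD1 i) //=.
  by apply: leeDl; apply: sume_ge0 => j _; apply: odds_ge0.
split => //; rewrite /tail_odds -sumEFin; apply: eq_bigr => i _.
by rewrite /odds lt_eqF.
Qed.

Lemma threshold_first n (p : 'I_n.+1 -> R) : p01 p ->
  (tail_odds (ptail p) 0 < 1)%E -> threshold p = ord0.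
Proof.
move=> h R1; rewrite /threshold; case: ifP => // R0.
case: arg_maxnP => //= s Rs _; apply: val_inj => /=.
case: (val s) Rs => // k; rewrite tail_oddsS leNgt => /negP[].
apply: le_lt_trans R1; apply: tail_odds_anti => // i; exact: h.
Qed.

Lemma threshold_max n (p : 'I_n.+1 -> R) (s : 'I_n.+1) :
  (1 <= tail_odds p s)%E ->
  p01 p ->
  (forall k : 'I_n.+1, (1 <= tail_odds p k)%E -> (k <= s)%N) ->
  threshold p = s.
Proof.
move=> Rs h max; rewrite /threshold.
have R0 : (1 <= tail_odds p 0)%E.
  by apply: le_trans Rs _; apply: tail_odds_anti.
rewrite R0; case: arg_maxnP => //= t Rt tmax.
by apply: val_inj; apply/eqP; rewrite eqn_leq max // tmax.
Qed.

Lemma threshold_ge1 n (p : 'I_n.+1 -> R) : (1 <= tail_odds p 0)%E ->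
  (1 <= tail_odds p (threshold p))%E /\
  (forall k : 'I_n.+1, (1 <= tail_odds p k)%E -> (k <= threshold p)%N).
Proof. by rewrite /threshold => R0; rewrite R0; case: arg_maxnP. Qed.

Lemma threshold_shift n (p : 'I_n.+2 -> R) : p01 p ->
  (1 <= tail_odds (ptail p) 0)%E ->
  threshold p = lift ord0 (threshold (ptail p)).
Proof.
move=> h R0; have [Rs smax] := threshold_ge1 R0.
apply: threshold_max => // [|k].
  by rewrite /= /bump /= add1n tail_oddsS.
rewrite /= /bump /= add1n; case: (unliftP ord0 k) => [j ->|-> //].
by rewrite /= /bump /= add1n tail_oddsS => /smax.
Qed.

Lemma formula_shift n (p : 'I_n.+2 -> R) : p01 p ->
  (1 <= tail_odds (ptail p) 0)%E -> odds_formula p = odds_formula (ptail p).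
Proof.
move=> h R0; rewrite /odds_formula threshold_shift //.
have prodS k : \prod_(j < n.+2 | (k < j)%N) (1 - p j)
    = \prod_(j < n.+1 | (k <= j)%N) (1 - ptail p j).
  by rewrite big_mkcond big_ord_recl /= mul1r -big_mkcond.
have sumS k : \sum_(j < n.+2 | (k < j)%N) p j / (1 - p j)
    = \sum_(j < n.+1 | (k <= j)%N) ptail p j / (1 - ptail p j).
  by rewrite big_mkcond big_ord_recl /= add0r -big_mkcond.
by rewrite -prodS -sumS -prodS.
Qed.

Lemma formula_first n (p : 'I_n.+1 -> R) : p01 p ->
  (tail_odds (ptail p) 0 < 1)%E ->
  odds_formula p = p ord0 * allq (ptail p)
    + (1 - p ord0) * (allq (ptail p) * \sum_i ptail p i / (1 - ptail p i)).
Proof.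
move=> h R1; rewrite /odds_formula threshold_first //.
have /andP[_ p1] := h ord0.
case: ltP => [lt1|ge1].
  rewrite !big_ord_recl /allq /ptail.
  have nz : 1 - p ord0 != 0 by rewrite subr_eq0 gt_eqF.
  set a := 1 - _; set b := \prod_(i < _) _; set d := \sum_(i < _) _.
  by field.
have -> : p ord0 = 1 by apply/eqP; rewrite eq_le p1.
rewrite subrr mul0r addr0 mul1r big_mkcond big_ord_recl /= mul1r.
by [].
Qed.

Lemma allq_le_formula n (p : 'I_n.+1 -> R) : p01 p ->
  (1 <= tail_odds p 0)%E -> allq p <= odds_formula p.
Proof.
move=> h R0; have [Rs smax] := threshold_ge1 R0; rewrite /odds_formula.
have q01 j : 0 <= 1 - p j <= 1.
  by have /andP[a b] := h j; rewrite subr_ge0 b lerBlDr lerDl ltW.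
have sub (P : pred 'I_n.+1) : allq p <= \prod_(j | P j) (1 - p j).
  rewrite /allq (bigID P) /= ler_piMr //.
    by apply: prodr_ge0 => j _; case/andP: (q01 j).
  by rewrite prodr_ile1 // => j _; apply: q01.
case: ltP => [lt1|ge1]; last exact: sub.
apply: le_trans (sub (fun j : 'I_n.+1 => (threshold p <= j)%N)) _.
rewrite ler_peMr //.
  by apply: prodr_ge0 => j _; case/andP: (q01 j).
rewrite -lee_fin; apply: le_trans Rs _; rewrite /tail_odds -sumEFin.
apply: lee_sum => i si; rewrite /odds; case: eqP => // pi1.
suff : (i <= threshold p)%N.
  move=> is_; have e : i = threshold p by apply: val_inj; apply/eqP; rewrite eqn_leq is_.
  by move: lt1; rewrite -e pi1 ltxx.
apply: smax; rewrite /tail_odds (bigD1 i) //=.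
apply: le_trans (_ : odds p i <= _)%E; first by rewrite /odds pi1 eqxx leey.
by apply: leeDl; apply: sume_ge0 => j _; apply: odds_ge0.
Qed.

Lemma dp_formula n (p : 'I_n.+1 -> R) : p01 p -> dp p = odds_formula p.
Proof.
elim: n p => [|n IH] p h.
  have R1 : (tail_odds (ptail p) 0 < 1)%E by rewrite /tail_odds big_ord0 lte_fin.
  rewrite formula_first // /= /allq !big_ord0 !mulr0 !addr0.
  by rewrite max_l // ler01.
have h' : p01 (ptail p) by move=> i; apply: h.
change (p ord0 * Num.max (allq (ptail p)) (dp (ptail p)) + (1 - p ord0) * dp (ptail p) = odds_formula p).
rewrite (IH _ h'); have [R0|R1] := leP 1%E (tail_odds (ptail p) 0).
  rewrite max_r; last exact: allq_le_formula.
  by rewrite formula_shift // -mulrDl addrC subrK mul1r.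
have [p1 RE] := tail_odds_fin h' R1.
have R2 : (tail_odds (ptail (ptail p)) 0 < 1)%E.
  by apply: le_lt_trans R1; rewrite -tail_oddsS; apply: tail_odds_anti.
have FE : odds_formula (ptail p) = allq (ptail p) * \sum_i ptail p i / (1 - ptail p i).
  by rewrite /odds_formula threshold_first // p1.
rewrite (formula_first h R1) FE max_l //.
rewrite ler_piMr ?allq_ge0 // ltW //.
by rewrite -lte_fin -RE.
Qed.

(* Bruss's odds theorem. *)
Lemma game_valueE n (p : 'I_n.+1 -> R) :
  (forall i, 0 < p i <= 1) -> game_value p = odds_formula p.
Proof. by move=> h; rewrite game_value_dp // dp_formula. Qed.

End OddsTheorem.

(* Main.v *)
Require Import Defs.
From HB Require Import structures.
From mathcomp Require Import all_boot all_order all_algebra.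
From mathcomp Require Import all_classical all_reals all_analysis.
From mathcomp Require Import ring lra.

Import Order.TTheory GRing.Theory Num.Theory.

Local Open Scope ring_scope.

(** Removing variables before the threshold, one may assume that the threshold
    is the first index. Let [A < 1] be the sum of the odds after it. Since
    [1 - p = 1 / (1 + r) >= exp (- r)], no later success occurs with probability
    [Q >= exp (- A)], and the value is [Q (p_s + (1 - p_s) A)]. The condition
    [r_s + A >= 1] gives [p_s + (1 - p_s) A >= 1 / (2 - A)], and
    [2 - A = 1 + (1 - A) < exp (1 - A)]. *)

Lemma expRN_odds_le (R : realType) (x : R) :
  x < 1 -> expR (- (x / (1 - x))) <= 1 - x.
Proof.
move=> x1; have q0 : 0 < 1 - x by rewrite subr_gt0.
rewrite expRN -[leRHS]invrK lef_pV2 ?posrE ?expR_gt0 ?invr_gt0 //.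
apply: le_trans (expR_ge1Dx _); rewrite [leLHS](_ : _ = 1 + x / (1 - x)) //.
by field; rewrite gt_eqF.
Qed.

Lemma expRN_sum_odds_le_allq {R : realType} {n : nat} (p : 'I_n -> R) :
  (forall i, p i < 1) -> expR (- \sum_i p i / (1 - p i)) <= allq p.
Proof.
move=> p1; rewrite -sumrN expR_sum; apply: ler_prod => i _.
by rewrite expR_ge0 expRN_odds_le.
Qed.

(** Here [x] is the success probability at the threshold. The third hypothesis is
    [x / (1 - x) + A >= 1] multiplied by [1 - x], a form that still makes sense for [x = 1], where
    the odds are infinite. *)
Lemma inv_expR1_lt (R : realType) (x A Q : R) :
  x <= 1 -> A < 1 -> 1 - x <= x + (1 - x) * A -> expR (- A) <= Q ->
  1 / expR 1 < Q * (x + (1 - x) * A).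
Proof.
move=> x1 A1 xA AQ.
have A2 : 0 < 2 - A by lra.
have key : 1 / (2 - A) <= x + (1 - x) * A.
  rewrite ler_pdivrMr // -subr_ge0.
  have -> : (x + (1 - x) * A) * (2 - A) - 1
    = (1 - A) * (x + (1 - x) * A - (1 - x)) by ring.
  by apply: mulr_ge0; rewrite subr_ge0 // ltW.
apply: (@lt_le_trans _ _ (expR (- A) * (1 / (2 - A)))); last first.
  by rewrite ler_pM ?expR_ge0 // divr_ge0 // ltW.
have -> : expR (- A) = expR (1 - A) / expR 1.
  by rewrite -expRB; congr expR; ring.
rewrite !mul1r ltr_pdivlMr // mulrC ltr_pM2r ?invr_gt0 ?expR_gt0 //.
have -> : 2 - A = 1 + (1 - A) by ring.
(* Strictness enters here, from [1 - A != 0]. *)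
by apply: expR_gt1Dx; rewrite subr_eq0 gt_eqF.
Qed.

Lemma formula_first_gt_inv_expR1 {R : realType} {n : nat} (p : 'I_n.+1 -> R) :
  p01 p -> (1 <= tail_odds p 0)%E -> (tail_odds (ptail p) 0 < 1)%E ->
  1 / expR 1 < odds_formula p.
Proof.
move=> h R0 R1; have [|p1 RE] := tail_odds_fin _ R1; first by move=> i; exact: h.
have /andP[p0_gt0 p0_le1] := h ord0.
rewrite formula_first //; move: R0 R1 (expRN_sum_odds_le_allq _ p1).
rewrite tail_odds0 RE lte_fin.
set A := \sum_i _ => R0 A1 AQ.
rewrite mulrCA [p ord0 * _]mulrC -mulrDr; apply: inv_expR1_lt => //.
have [p0E|p0_neq1] := eqVneq (p ord0) 1; first by rewrite p0E; lra.
move: R0; rewrite /odds (negbTE p0_neq1) -EFinD lee_fin.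
have q0 : 0 < 1 - p ord0 by rewrite subr_gt0 lt_neqAle p0_neq1.
by rewrite -(ler_pM2l q0) mulr1 mulrDr mulrCA divff ?mulr1 // gt_eqF.
Qed.

(** While the odds after the first variable still sum to at least 1, dropping that variable leaves
    the formula unchanged. With a single variable that sum is empty. *)
Lemma odds_formula_gt_inv_expR1 {R : realType} {n : nat} (p : 'I_n.+1 -> R) :
  p01 p -> (1 <= tail_odds p 0)%E -> 1 / expR 1 < odds_formula p.
Proof.
elim: n p => [|n IH] p h R0.
  by apply: formula_first_gt_inv_expR1; rewrite // /tail_odds big_ord0 lte_fin.
have [R1|R1] := leP 1%E (tail_odds (ptail p) 0).
  by rewrite formula_shift //; apply: IH => // i; exact: h.
exact: formula_first_gt_inv_expR1.
Qed.

Theorem theorem6 (R : realType) (n : nat) (p : 'I_n.+1 -> R)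
    (p01 : forall i : 'I_n.+1, 0 < p i <= 1)
    (odds_ge1 : (1 <= tail_odds p (threshold p) <= +oo)%E) :
  1 / expR 1 < game_value p.
Proof.
rewrite game_valueE //; apply: odds_formula_gt_inv_expR1 => //.
have /andP[Rs _] := odds_ge1.
by apply: le_trans Rs _; exact: tail_odds_anti.
Qed.
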